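(* For every complex number $q$ with $|q|<1$, $$\sum_{n=0}^\infty \frac{q^{n^2}(-1;q)_n}{(q;q^2)_n(q;q)_n} = \frac{f(-q^3,-q^3)}{\varphi(-q)} = \frac{(q^3;q^3)_\infty(q^3;q^6)_\infty}{(q;q)_\infty(q;q^2)_\infty}.$$
   Context: Notation: $(a;q)_n=\prod_{j=0}^{n-1}(1-aq^j)$ (so $(a;q)_0=1$) and $(a;q)_\infty=\prod_{j=0}^\infty(1-aq^j)$; the base may be replaced by a power of $q$. Ramanujan's theta function is $f(a,b)=\sum_{n=-\infty}^\infty a^{n(n+1)/2}b^{n(n-1)/2}$ for $|ab|<1$ (with $0^0=1$), and $\varphi(q)=f(q,q)$; $\varphi(-q)$ is $\varphi$ evaluated at $-q$. *)

(* Defs.v *)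
From Stdlib Require Import Reals ZArith.
From Coquelicot Require Import Coquelicot.

Local Open Scope C_scope.

(* Taken componentwise, like [C_lim]; it is the limit of [u] whenever [u]
   converges ([Clim_seq_unique]) and a junk value otherwise. *)
Definition Clim_seq (u : nat -> C) : C :=
  (real (Lim_seq (fun n => fst (u n))), real (Lim_seq (fun n => snd (u n)))).

Definition CSeries (a : nat -> C) : C := Clim_seq (sum_n a).

(* (a;q)_n *)
Fixpoint qpoch (a q : C) (n : nat) : C :=
  match n with
  | O => 1
  | S m => qpoch a q m * (1 - a * q ^ m)
  end.

(* (a;q)_oo, meaningful for |q| < 1 *)
Definition qpoch_inf (a q : C) : C := Clim_seq (qpoch a q).

(* The exponents n(n+1)/2 and n(n-1)/2 are natural numbers for every integer n,
   so the integer divisions are exact and [Z.to_nat] never truncates.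
   [Cpow 0 0] is 1. *)
Definition theta_term (a b : C) (n : Z) : C :=
  a ^ Z.to_nat (n * (n + 1) / 2) * b ^ Z.to_nat (n * (n - 1) / 2).

(* Ramanujan's f(a,b), meaningful for |ab| < 1: the bilateral series is summed
   as n >= 0 and n < 0 separately, both parts being absolutely convergent. *)
Definition theta (a b : C) : C :=
  CSeries (fun k => theta_term a b (Z.of_nat k)) +
  CSeries (fun k => theta_term a b (- Z.of_nat (S k))).

Definition phi (q : C) : C := theta q q.

Lemma Clim_seq_unique (u : nat -> C) (l : C) :
  filterlim u eventually (locally l) -> Clim_seq u = l.
Proof.
intros H; destruct l as [x y]; unfold Clim_seq; f_equal.
- rewrite (is_lim_seq_unique (fun n => fst (u n)) x); [reflexivity|].
  eapply filterlim_comp; [exact H|].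
  intros P [e He]; exists e; intros z [Hz _]; apply He, Hz.
- rewrite (is_lim_seq_unique (fun n => snd (u n)) y); [reflexivity|].
  eapply filterlim_comp; [exact H|].
  intros P [e He]; exists e; intros z [_ Hz]; apply He, Hz.
Qed.

(* Main.v *)
Require Import Defs.
From Stdlib Require Import Reals ZArith.
From Stdlib Require Import Lia Lra.
From Coquelicot Require Import Coquelicot.

Local Open Scope C_scope.

(** The series is an instance of Bailey's lemma.  Put, for n >= 0,

      beta_n = q^(n(n-1)/2) / ((q;q)_n (q;q^2)_n),

    so that the summand is (-1;q)_n q^(n(n+1)/2) beta_n.  With
    alpha_(2m) = (-1)^m q^(m^2-m) (1 + q^(2m)) for m > 0, alpha_0 = 1 and
    alpha_r = 0 for odd r, one has [bailey_pair]

      beta_n = sum_(r >= 0) alpha_r / ((q;q)_(n-r) (q;q)_(n+r)).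

    A summation of q-Vandermonde type [q_vandermonde] evaluates, for each r,
    the sum over n of (-1;q)_n q^(n(n+1)/2) against
    1 / ((q;q)_(N-n) (q;q)_(n-r) (q;q)_(n+r)).  Inserting the first identity in
    the second and exchanging two finite sums gives [bailey_transform]:

      sum_n q^(n^2) (-1;q)_n / ((q;q^2)_n (q;q)_n) / (q;q)_(N-n)
        = (-q;q)_N sum_(m in Z) (-1)^m q^(3m^2) / ((q;q)_(N-2m) (q;q)_(N+2m)).

    As N tends to infinity, Tannery's theorem [tannery] turns this into
    series = (-q;q)_oo / (q;q)_oo * f(-q^3,-q^3).

    The factor is 1/phi(-q) by Gauss's phi(-q) = (q;q)_oo / (-q;q)_oo [gauss],
    which is the limit in the same sense of the finite identity [gauss_finite];
    By Euler's (q;q^2)_oo (-q;q)_oo = 1 [euler_odd], phi(-q) is also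
    (q;q)_oo (q;q^2)_oo; this for q and for q^3 gives the product side.

    The identities [bailey_pair], [q_vandermonde] and [gauss_finite] are proved by
    induction on the upper parameter.  The two sides satisfy the same first-order recurrence: applied to
    the summand, the recurrence leaves a difference G(m+1) - G(m), so it holds for
    the sum.  Once such a certificate G is known, only a polynomial identity in
    powers of q remains.  Sums over all integers m, whose summands are even, are
    folded onto m >= 0 by the weight [sym_weight]. *)

(** * Finite sums and telescoping *)

(** The type C in place of the carrier of an abstract monoid lets [ring] and
    rewriting act on sums. *)
Definition csum (f : nat -> C) (n : nat) : C := sum_n (G := C_AbelianMonoid) f n.

Lemma csum_0 (f : nat -> C) : csum f 0 = f 0%nat.
Proof. apply sum_O. Qed.

Lemma csum_S (f : nat -> C) n : csum f (S n) = csum f n + f (S n).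
Proof. exact (sum_Sn (G := C_AbelianMonoid) f n). Qed.

Lemma csum_scal (c : C) (f : nat -> C) n : csum (fun k => c * f k) n = c * csum f n.
Proof. exact (sum_n_mult_l (K := C_Ring) c f n). Qed.

Lemma csum_ext (f g : nat -> C) n :
  (forall k, (k <= n)%nat -> f k = g k) -> csum f n = csum g n.
Proof. exact (sum_n_ext_loc (G := C_AbelianMonoid) f g n). Qed.

Lemma csum_switch (f : nat -> nat -> C) m n :
  csum (fun i => csum (f i) n) m = csum (fun j => csum (fun i => f i j) m) n.
Proof. exact (sum_n_switch (G := C_AbelianMonoid) f m n). Qed.

Lemma csum_single (f : nat -> C) (r K : nat) :
  (r <= K)%nat -> (forall n, (n <= K)%nat -> n <> r -> f n = 0) ->
  csum f K = f r.
Proof.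
intros Hr Hf.
assert (H : forall K', (K' <= K)%nat ->
  csum f K' = if (r <=? K')%nat then f r else 0).
{ induction K' as [|k IH]; intros Hk.
  - rewrite csum_0; destruct r; [reflexivity|apply Hf; lia].
  - rewrite csum_S, IH by lia.
    destruct (Nat.leb_spec r k); destruct (Nat.leb_spec r (S k)); try lia.
    + rewrite (Hf (S k)) by lia; ring.
    + replace r with (S k) by lia; ring.
    + rewrite (Hf (S k)) by lia; ring. }
rewrite H by lia; destruct (Nat.leb_spec r K); [reflexivity|lia].
Qed.

Lemma Cmult_cancel_l (c x y : C) : c <> 0 -> c * x = c * y -> x = y.
Proof.
intros Hc H; rewrite <- (Cmult_1_l x), <- (Cmult_1_l y), <- (Cinv_l c Hc).
rewrite <- !Cmult_assoc, H; reflexivity.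
Qed.

(** The sum over all integers of an even function f is the sum over m >= 0 of
    [sym_weight m * f m]. *)
Definition sym_weight (m : nat) : C := match m with O => 1 | S _ => 2 end.

(** The weight doubles every difference but the one at m = 0, so the sum of
    weighted differences is 2 G(K+1) - G(0) - G(1).  The condition
    G(0) = - G(1) says that G is the restriction of a certificate on the
    integers which is odd about 1/2. *)
Lemma telescope_sym (f g G : nat -> C) (c d : C) (K : nat) :
  (forall m, c * f m = d * g m + sym_weight m * (G (S m) - G m)) ->
  G 0%nat = - G 1%nat -> G (S K) = 0 ->
  c * csum f K = d * csum g K.
Proof.
intros H H0 HK.
assert (c * csum f K = d * csum g K + 2 * G (S K)) as ->; [|rewrite HK; ring].
clear HK; induction K as [|K IH].
- rewrite !csum_0, H, H0; simpl; ring.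
- rewrite !csum_S, Cmult_plus_distr_l, IH, H; simpl sym_weight; ring.
Qed.

Lemma telescope (f g G : nat -> C) (c d : C) (K : nat) :
  (forall m, c * f m = d * g m + (G (S m) - G m)) ->
  G 0%nat = 0 -> G (S K) = 0 ->
  c * csum f K = d * csum g K.
Proof.
intros H H0 HK.
assert (c * csum f K = d * csum g K + G (S K)) as ->; [|rewrite HK; ring].
clear HK; induction K as [|K IH].
- rewrite !csum_0, H, H0; ring.
- rewrite !csum_S, Cmult_plus_distr_l, IH, H; ring.
Qed.

(** * Limits of complex sequences and series *)

Notation is_cseries := (is_series (K := C_AbsRing) (V := C_NormedModule)).

(** Coquelicot carries several uniform structures on C.  This is the one of
    [Clim_seq_unique], and that of [is_cseries] is convertible to it; the one for which
    products are continuous is only equivalent to it, which is the point of [conv_mult]. *)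
Definition conv (u : nat -> C) (l : C) : Prop :=
  filterlim u eventually (locally (T := C_UniformSpace) l).

Lemma conv_ext (u v : nat -> C) (l : C) :
  (forall n, u n = v n) -> conv u l -> conv v l.
Proof. intros H; apply filterlim_ext; exact H. Qed.

Lemma conv_const (c : C) : conv (fun _ => c) c.
Proof. apply filterlim_const. Qed.

Lemma conv_unique (u : nat -> C) (l l' : C) : conv u l -> conv u l' -> l = l'.
Proof.
intros H H'; rewrite <- (Clim_seq_unique u l H); exact (Clim_seq_unique u l' H').
Qed.

Lemma conv_mult (u v : nat -> C) (a b : C) :
  conv u a -> conv v b -> conv (fun n => u n * v n) (a * b).
Proof.
intros Hu Hv P HP.
apply (filterlim_comp_2 (F := eventually) u v (mult (K := C_AbsRing))
  (G := locally (T := AbsRing_UniformSpace C_AbsRing) a)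
  (H := locally (T := AbsRing_UniformSpace C_AbsRing) b)
  (I := locally (T := AbsRing_UniformSpace C_AbsRing) (a * b))).
- intros Q HQ; apply Hu; apply (locally_C a Q); exact HQ.
- intros Q HQ; apply Hv; apply (locally_C b Q); exact HQ.
- exact (filterlim_mult (K := C_AbsRing) a b).
- apply (locally_C (a * b) P); exact HP.
Qed.

Lemma conv_eps (u : nat -> C) (l : C) :
  conv u l <-> forall eps : R, (0 < eps)%R ->
    exists N, forall n, (N <= n)%nat -> (Cmod (u n - l) < eps)%R.
Proof.
split.
- intros H eps He.
  destruct (proj1 (filterlim_locally_ball_norm (K := C_AbsRing)
    (U := C_NormedModule) (F := eventually) u l) H (mkposreal eps He)) as [N HN].
  exists N; intros n Hn; exact (HN n Hn).
- intros H.
  apply (proj2 (filterlim_locally_ball_norm (K := C_AbsRing)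
    (U := C_NormedModule) (F := eventually) u l)).
  intros eps; destruct (H eps (cond_pos eps)) as [N HN].
  exists N; intros n Hn; exact (HN n Hn).
Qed.

Lemma conv_subseq_ge (u : nat -> C) (s : nat -> nat) (k : nat) (l : C) :
  (forall n, (n <= s n + k)%nat) -> conv u l -> conv (fun n => u (s n)) l.
Proof.
intros Hs; apply filterlim_comp; intros P [N HN].
exists (N + k)%nat; intros n Hn; apply HN; specialize (Hs n); lia.
Qed.

Lemma ex_series_geom_scal (c : R) (q : C) : (Cmod q < 1)%R ->
  ex_series (fun n => (c * Cmod q ^ n)%R).
Proof.
intros Hq; apply (ex_series_scal_l (K := R_AbsRing) (V := R_NormedModule) c).
apply ex_series_geom; rewrite Rabs_pos_eq by apply Cmod_ge_0; exact Hq.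
Qed.

Lemma is_cseries_scal (c : C) (f : nat -> C) (l : C) :
  is_cseries f l -> is_cseries (fun n => c * f n) (c * l).
Proof. exact (is_series_scal_l (K := C_AbsRing) (V := C_NormedModule) c f l). Qed.

Lemma CSeries_correct (f : nat -> C) :
  ex_series (K := C_AbsRing) (V := C_NormedModule) f -> is_cseries f (CSeries f).
Proof.
intros [l Hl]; change (CSeries f) with (Clim_seq (csum f)).
rewrite (Clim_seq_unique (csum f) l Hl); exact Hl.
Qed.

(** The bound 1 + x <= exp x majorizes the partial products by a geometric
    sum in the exponent; their differences [P n * u n] are then dominated by a
    geometric series.  Reciprocals of shifted factorials are also products
    of this shape, which is how nonvanishing of the limits is obtained later. *)
Lemma infinite_product_cv (P u : nat -> C) (c rho : R) :
  (0 <= rho < 1)%R -> (0 <= c)%R ->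
  P 0%nat = 1 -> (forall n, P (S n) = P n * (1 + u n)) ->
  (forall n, Cmod (u n) <= c * rho ^ n)%R ->
  (forall n, Cmod (P n) <= exp (c / (1 - rho)))%R /\ exists l, conv P l.
Proof.
intros Hr Hc H0 HS Hu.
assert (Hb : forall n, (Cmod (P n) <= exp (c * ((1 - rho ^ n) / (1 - rho))))%R).
{ induction n as [|n IH].
  - rewrite H0, Cmod_1; simpl.
    replace (c * ((1 - 1) / (1 - rho)))%R with 0%R by (field; lra).
    rewrite exp_0; lra.
  - rewrite HS, Cmod_mult.
    replace (c * ((1 - rho ^ S n) / (1 - rho)))%R
      with (c * ((1 - rho ^ n) / (1 - rho)) + c * rho ^ n)%R
      by (simpl; field; lra).
    rewrite exp_plus.
    apply Rmult_le_compat; try apply Cmod_ge_0; [exact IH|].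
    apply Rle_trans with (1 + c * rho ^ n)%R.
    + eapply Rle_trans; [apply Cmod_triangle|].
      rewrite Cmod_1; specialize (Hu n); lra.
    + apply exp_ineq1_le. }
assert (Hb' : forall n, (Cmod (P n) <= exp (c / (1 - rho)))%R).
{ intros n; eapply Rle_trans; [apply Hb|].
  assert (H : (c * ((1 - rho ^ n) / (1 - rho)) <= c / (1 - rho))%R).
  { unfold Rdiv; rewrite <- Rmult_assoc.
    apply Rmult_le_compat_r; [left; apply Rinv_0_lt_compat; lra|].
    assert (0 <= rho ^ n)%R by (apply pow_le; lra); nra. }
  destruct H as [H|H]; [left; apply exp_increasing; exact H|rewrite H; lra]. }
split; [exact Hb'|].
set (d := (fun n => match n with O => 1 | S k => P k * u k end) : nat -> C).
assert (Hex : ex_series (K := C_AbsRing) (V := C_NormedModule) d).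
{ apply (proj2 (ex_series_incr_1 (K := C_AbsRing) (V := C_NormedModule) d)).
  apply (ex_series_le (K := C_AbsRing) (V := C_CompleteNormedModule) _
    (fun n => scal (exp (c / (1 - rho)) * c)%R (rho ^ n)%R)).
  - intros n; change (Cmod (P n * u n)
      <= exp (c / (1 - rho)) * c * rho ^ n)%R.
    rewrite Cmod_mult, Rmult_assoc.
    apply Rmult_le_compat; try apply Cmod_ge_0; [apply Hb'|apply Hu].
  - apply (ex_series_scal_l (K := R_AbsRing) (V := R_NormedModule)).
    apply ex_series_geom; rewrite Rabs_pos_eq; lra. }
destruct Hex as [l Hl]; exists l.
apply conv_ext with (sum_n (G := C_AbelianMonoid) d); [|exact Hl].
induction n as [|n IH]; [rewrite sum_O; simpl; rewrite H0; reflexivity|].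
rewrite sum_Sn, IH, HS; unfold plus; simpl; ring.
Qed.

(** Tannery's theorem (dominated convergence for series): cut all sums at
    a K beyond which the tail of the majorant is small, and pass to the limit in the
    finite sum up to K. *)
Lemma tannery (F : nat -> nat -> C) (g : nat -> C) (M : nat -> R) :
  ex_series M -> (forall N m, Cmod (F N m) <= M m)%R ->
  (forall m, conv (fun N => F N m) (g m)) ->
  exists l, is_cseries g l /\ conv (fun N => csum (F N) N) l.
Proof.
unfold csum; intros HM HF Hg.
assert (HgM : forall m, (Cmod (g m) <= M m)%R).
{ intros m; apply Rnot_lt_le; intros Hlt.
  destruct (proj1 (conv_eps _ _) (Hg m) (Cmod (g m) - M m)%R ltac:(lra)) as [N HN].
  specialize (HN N (le_n N)); specialize (HF N m).
  assert (Ht := Cmod_triangle (g m - F N m) (F N m)).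
  replace (g m - F N m + F N m) with (g m) in Ht by ring.
  rewrite <- Cmod_opp in HN.
  replace (- (F N m - g m)) with (g m - F N m) in HN by ring; lra. }
assert (Hex : ex_series (K := C_AbsRing) (V := C_NormedModule) g)
  by exact (ex_series_le (K := C_AbsRing) (V := C_CompleteNormedModule) g M HgM HM).
destruct Hex as [l Hl]; exists l; split; [exact Hl|].
apply conv_eps; intros eps He.
destruct (Cauchy_ex_series M HM (mkposreal (eps / 4) ltac:(lra))) as [K HK].
simpl in HK.
assert (Htail : forall (a : nat -> C) n, (forall m, Cmod (a m) <= M m)%R ->
  (K <= n)%nat -> (Cmod (sum_n (G := C_AbelianMonoid) a n
     - sum_n (G := C_AbelianMonoid) a K) < eps / 4)%R).
{ intros a n Ha Hn; destruct (Nat.eq_dec n K) as [->|Hne].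
  - replace (sum_n a K - sum_n a K) with (RtoC 0) by ring; rewrite Cmod_0; lra.
  - change (Cmod (minus (G := C_AbelianGroup) (sum_n a n) (sum_n a K)) < eps / 4)%R.
    rewrite <- (sum_n_m_sum_n (G := C_AbelianGroup)) by exact Hn.
    eapply Rle_lt_trans; [|apply (HK (S K) n); lia].
    eapply Rle_trans; [|apply Rle_abs].
    eapply Rle_trans;
      [apply (norm_sum_n_m (K := C_AbsRing) (V := C_NormedModule))|].
    apply sum_n_m_le; exact Ha. }
assert (HK2 : conv (fun N => sum_n (G := C_AbelianMonoid) (F N) K)
   (sum_n (G := C_AbelianMonoid) g K)).
{ clear -Hg; induction K as [|K IH].
  - rewrite sum_O; apply conv_ext with (2 := Hg 0%nat).
    intros n; rewrite sum_O; reflexivity.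
  - rewrite sum_Sn.
    apply conv_ext with (fun N => plus (sum_n (G := C_AbelianMonoid) (F N) K) (F N (S K))).
    + intros n; rewrite sum_Sn; reflexivity.
    + apply (filterlim_comp_2 (F := eventually) _ _ _ IH (Hg (S K))).
      apply (filterlim_plus (K := C_AbsRing) (V := C_NormedModule)). }
destruct (proj1 (conv_eps _ _) HK2 (eps / 4)%R ltac:(lra)) as [N1 H1].
destruct (proj1 (conv_eps _ _) Hl (eps / 4)%R ltac:(lra)) as [N2 H2].
exists (Nat.max K (Nat.max N1 N2)); intros n Hn.
specialize (H1 n ltac:(lia)); specialize (H2 n ltac:(lia)).
assert (H3 := Htail (F n) n (HF n) ltac:(lia)).
assert (H4 := Htail g n HgM ltac:(lia)).
set (a := sum_n (F n) n) in *; set (b := sum_n (F n) K) in *.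
set (c := sum_n g K) in *; set (d := sum_n g n) in *.
replace (a - l) with ((a - b) + ((b - c) + (- (d - c) + (d - l)))) by ring.
assert (T1 := Cmod_triangle (a - b) ((b - c) + (- (d - c) + (d - l)))).
assert (T2 := Cmod_triangle (b - c) (- (d - c) + (d - l))).
assert (T3 := Cmod_triangle (- (d - c)) (d - l)).
rewrite Cmod_opp in T3; change (Cmod (d - l) < eps / 4)%R in H2; lra.
Qed.

(** * Shifted factorials *)

Lemma Cmod_lt_1_neq (z : C) : (Cmod z < 1)%R -> 1 - z <> 0.
Proof.
intros H E; assert (z = 1) by (replace z with (1 - (1 - z)) by ring; rewrite E; ring).
subst; rewrite Cmod_1 in H; lra.
Qed.

Lemma Cmod_pow_lt_1 (q : C) n : (Cmod q < 1)%R -> (Cmod (q ^ S n) < 1)%R.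
Proof.
intros H; rewrite Cmod_pow; apply pow_lt_1_compat; [split; [apply Cmod_ge_0|exact H]|lia].
Qed.

Lemma one_minus_pow_neq (q : C) n : (Cmod q < 1)%R -> 1 - q ^ S n <> 0.
Proof. intros H; apply Cmod_lt_1_neq, Cmod_pow_lt_1, H. Qed.

Lemma Cmod_mul_pow_le (a q : C) n :
  (Cmod q < 1)%R -> (Cmod (a * q ^ n) <= Cmod a)%R.
Proof.
intros H; rewrite Cmod_mult, Cmod_pow.
assert (Cmod q ^ n <= 1)%R.
{ rewrite <- (pow1 n); apply pow_incr; split; [apply Cmod_ge_0|lra]. }
assert (Ha := Cmod_ge_0 a); nra.
Qed.

Lemma qpoch_neq (a q : C) n :
  (Cmod a < 1)%R -> (Cmod q < 1)%R -> qpoch a q n <> 0.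
Proof.
intros Ha Hq; induction n as [|n IH]; simpl.
- intros E; apply (f_equal fst) in E; simpl in E; lra.
- apply Cmult_neq_0; [exact IH|].
  apply Cmod_lt_1_neq; eapply Rle_lt_trans; [apply Cmod_mul_pow_le|]; assumption.
Qed.

(** The exponent n(n-1)/2 in a form free of division. *)
Fixpoint tri (n : nat) : nat := match n with O => O | S m => tri m + m end.

Lemma tri_square n : (n ^ 2 = 2 * tri n + n)%nat.
Proof. induction n as [|n IH]; simpl in *; nia. Qed.

(** 1/(q;q)_(n-k), which is 0 when n - k < 0.  With this convention the finite
    identities may be summed over any sufficiently long range, and the recurrence
    [inv_qfact_step] holds for all n and k. *)
Definition inv_qfact (q : C) (n k : nat) : C :=
  if (k <=? n)%nat then / qpoch q q (n - k) else 0.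

Lemma inv_qfact_SS q n k : inv_qfact q (S n) (S k) = inv_qfact q n k.
Proof. reflexivity. Qed.

Lemma inv_qfact_0 q n k : (n < k)%nat -> inv_qfact q n k = 0.
Proof. intros H; unfold inv_qfact; destruct (Nat.leb_spec k n); [lia|reflexivity]. Qed.

Lemma inv_qfact_diag q n : inv_qfact q n n = 1.
Proof.
unfold inv_qfact; rewrite Nat.leb_refl, Nat.sub_diag; simpl; field.
Qed.

Lemma inv_qpoch_step (q : C) n : (Cmod q < 1)%R ->
  / qpoch q q n = (1 - q ^ S n) * / qpoch q q (S n).
Proof.
intros Hq; change (qpoch q q (S n)) with (qpoch q q n * (1 - q ^ S n)); field.
split; [apply one_minus_pow_neq, Hq|apply qpoch_neq; assumption].
Qed.

(** At k = n + 1 the factor vanishes, so the step into the region where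
    the symbol is 0 is covered too. *)
Lemma inv_qfact_step (q : C) n k : (Cmod q < 1)%R ->
  inv_qfact q n k = (1 - q ^ (S n - k)) * inv_qfact q (S n) k.
Proof.
intros Hq; unfold inv_qfact.
destruct (Nat.leb_spec k n); destruct (Nat.leb_spec k (S n)); try lia.
- rewrite Nat.sub_succ_l by lia; apply inv_qpoch_step, Hq.
- replace (S n - k)%nat with 0%nat by lia; simpl; ring.
- ring.
Qed.

Lemma one_plus_pow_neq (q : C) n : (Cmod q < 1)%R -> 1 + q ^ n <> 0.
Proof.
intros Hq; destruct n as [|n].
- simpl; intros E; apply (f_equal fst) in E; simpl in E; lra.
- replace (1 + q ^ S n) with (1 - - q ^ S n) by ring.
  apply Cmod_lt_1_neq; rewrite Cmod_opp; apply Cmod_pow_lt_1, Hq.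
Qed.

(** * Finite identities *)

(** Without the weight, the summand t_n(m) obeys
    (1 - q^(2n+2)) t_(n+1)(m) = t_n(m) + G(m+1) - G(m). *)
Lemma gauss_finite (q : C) (n K : nat) : (Cmod q < 1)%R -> (n <= K)%nat ->
  csum (fun m => sym_weight m * (-(1)) ^ m * q ^ (m ^ 2) *
      (inv_qfact q n m * / qpoch q q (n + m))) K
  = / (qpoch q q n * qpoch (- q) q n).
Proof.
intros Hq; induction n as [|n IH]; intros Hn.
- rewrite csum_single with (r := 0%nat).
  + rewrite inv_qfact_diag; simpl; field.
  + lia.
  + intros m _ Hm; rewrite inv_qfact_0 by lia; ring.
- set (G := fun m => - ((-(1)) ^ m * q ^ (2 * tri m) * q ^ S n *
     inv_qfact q (S n) m * / qpoch q q (n + m))).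
  assert (Hc : (1 - q ^ S n) * (1 + q ^ S n) <> 0)
    by (apply Cmult_neq_0; [apply one_minus_pow_neq|apply one_plus_pow_neq]; exact Hq).
  apply (Cmult_cancel_l _ _ _ Hc).
  rewrite (telescope_sym _ (fun m => sym_weight m * (-(1)) ^ m * q ^ (m ^ 2) *
      (inv_qfact q n m * / qpoch q q (n + m))) G _ 1).
  + rewrite IH by lia.
    change (qpoch q q (S n)) with (qpoch q q n * (1 - q ^ S n)).
    change (qpoch (- q) q (S n)) with (qpoch (- q) q n * (1 - - q * q ^ n)).
    replace (1 - - q * q ^ n) with (1 + q ^ S n) by (simpl; ring).
    field.
    repeat split; try (apply one_minus_pow_neq, Hq); try (apply one_plus_pow_neq, Hq);
      apply qpoch_neq; rewrite ?Cmod_opp; assumption.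
  + intros m. unfold G; rewrite tri_square.
    rewrite inv_qfact_SS.
    replace (S n + m)%nat with (S (n + m)) by lia.
    replace (n + S m)%nat with (S (n + m)) by lia.
    rewrite (inv_qpoch_step q (n + m)) by exact Hq.
    replace (2 * tri (S m))%nat with (2 * tri m + m + m)%nat by (simpl; lia).
    destruct (Nat.lt_ge_cases (S n) m) as [H|H].
    { rewrite !inv_qfact_0 by lia; ring. }
    assert (exists j, S n = j + m)%nat as [j E] by (exists (S n - m)%nat; lia).
    rewrite (inv_qfact_step q n m) by exact Hq.
    replace (S n - m)%nat with j by lia.
    replace (S (n + m)) with (j + m + m)%nat by lia; rewrite E.
    generalize (inv_qfact q (j + m) m) as I; intros I.
    generalize (/ qpoch q q (j + m + m)) as J; intros J.
    rewrite !Cpow_add_r; simpl Cpow; ring.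
  + unfold G.
    replace (n + 0)%nat with n by lia; replace (n + 1)%nat with (S n) by lia.
    rewrite inv_qfact_SS, (inv_qfact_step q n 0) by exact Hq.
    rewrite (inv_qpoch_step q n) by exact Hq.
    simpl; ring.
  + unfold G; rewrite inv_qfact_0 by lia; ring.
Qed.

(** The term alpha_(2m) of the Bailey sequence.  At m = 0 the factor
    (1 + q^0)/2 is 1; for m > 0 the 2 of [sym_weight] cancels the denominator. *)
Definition bailey_alpha (q : C) (m : nat) : C :=
  sym_weight m * (-(1)) ^ m * q ^ (2 * tri m) * (1 + q ^ (2 * m)) / 2.

(** This is Bailey's relation at a = 1 for the sequence supported on even indices.
    It amounts to summing (-1)^m q^(m^2-m) / ((q;q)_(n-2m) (q;q)_(n+2m)) over all
    integers m; averaging the terms m and -m, whence the factor (1 + q^(2m))/2,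
    is what makes the recurrence telescope. *)
Lemma bailey_pair (q : C) (n K : nat) : (Cmod q < 1)%R -> (n <= K)%nat ->
  csum (fun m => bailey_alpha q m *
      (inv_qfact q n (2 * m) * / qpoch q q (n + 2 * m))) K
  = q ^ tri n / (qpoch q q n * qpoch q (q ^ 2) n).
Proof.
intros Hq; induction n as [|n IH]; intros Hn.
- rewrite csum_single with (r := 0%nat).
  + unfold bailey_alpha; rewrite inv_qfact_diag; simpl; field.
  + lia.
  + intros m _ Hm; rewrite inv_qfact_0 by lia; ring.
- set (G := fun m => - ((-(1)) ^ m * q ^ (2 * tri m) * (1 - q ^ (n + 2 * m))
     * inv_qfact q (S n) (2 * m) * / qpoch q q (n + 2 * m) / 2)).
  assert (Hc : (1 - q ^ S n) * (1 - q ^ S (2 * n)) <> 0)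
    by (apply Cmult_neq_0; apply one_minus_pow_neq, Hq).
  apply (Cmult_cancel_l _ _ _ Hc).
  rewrite (telescope_sym _ (fun m => bailey_alpha q m *
      (inv_qfact q n (2 * m) * / qpoch q q (n + 2 * m))) G _ (q ^ n)).
  + rewrite IH by lia; simpl tri.
    change (qpoch q q (S n)) with (qpoch q q n * (1 - q ^ S n)).
    change (qpoch q (q ^ 2) (S n)) with (qpoch q (q ^ 2) n * (1 - q * (q ^ 2) ^ n)).
    rewrite <- Cpow_mult_r, <- Cpow_S, Cpow_add_r; field.
    repeat split; try (apply one_minus_pow_neq, Hq); apply qpoch_neq;
      try assumption; apply (Cmod_pow_lt_1 q 1 Hq).
  + intros m. unfold G, bailey_alpha.
    replace (2 * S m)%nat with (S (S (2 * m))) by lia.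
    rewrite inv_qfact_SS.
    replace (S n + 2 * m)%nat with (S (n + 2 * m)) by lia.
    replace (n + S (S (2 * m)))%nat with (S (S (n + 2 * m))) by lia.
    rewrite (inv_qpoch_step q (n + 2 * m)), (inv_qpoch_step q (S (n + 2 * m))) by exact Hq.
    replace (2 * tri (S m))%nat with (2 * tri m + 2 * m)%nat by (simpl; lia).
    destruct (Nat.lt_ge_cases (S n) (2 * m)) as [H|H].
    { rewrite !inv_qfact_0 by lia. unfold Cdiv; ring. }
    (* At 2m = n + 1 the symbol with index n is already 0; only the term of
       index n + 1 and G(m) remain. *)
    destruct (Nat.eq_dec (2 * m) (S n)) as [E|E].
    { rewrite (inv_qfact_0 q n (2 * m)), (inv_qfact_0 q n (S (2 * m))) by lia.
      rewrite E, inv_qfact_diag. simpl Cpow.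
      rewrite !Cpow_add_r; simpl Cpow. unfold Cdiv; ring. }
    assert (exists j, n = j + 2 * m)%nat as [j ->] by (exists (n - 2 * m)%nat; lia).
    rewrite (inv_qfact_step q _ (S (2 * m))), inv_qfact_SS by exact Hq.
    rewrite (inv_qfact_step q (j + 2 * m) (2 * m)) by exact Hq.
    replace (S (j + 2 * m) - S (2 * m))%nat with j by lia.
    replace (S (j + 2 * m) - 2 * m)%nat with (S j) by lia.
    generalize (inv_qfact q (S (j + 2 * m)) (2 * m)) as I; intros I.
    generalize (/ qpoch q q (S (S (j + 2 * m + 2 * m)))) as J; intros J.
    simpl Cpow; rewrite !Cpow_add_r; simpl Cpow; unfold Cdiv; ring.
  + unfold G; change (2 * 0)%nat with 0%nat; change (2 * 1)%nat with 2%nat.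
    replace (n + 0)%nat with n by lia; replace (n + 2)%nat with (S (S n)) by lia.
    rewrite inv_qfact_SS, (inv_qfact_step q n 1), inv_qfact_SS by exact Hq.
    rewrite (inv_qfact_step q n 0) by exact Hq.
    rewrite (inv_qpoch_step q n), (inv_qpoch_step q (S n)) by exact Hq.
    replace (S n - 1)%nat with n by lia.
    simpl; unfold Cdiv; ring.
  + unfold G; rewrite inv_qfact_0 by lia; unfold Cdiv; ring.
Qed.

Lemma qpoch_minus_one (q : C) n : qpoch (-(1)) q n * (1 + q ^ n) = 2 * qpoch (- q) q n.
Proof.
induction n as [|n IH]; [simpl; ring|].
cbn [qpoch]; rewrite (Cmult_assoc 2), <- IH; simpl; ring.
Qed.

(** The summand of the terminating q-Vandermonde sum with first parameter -q^r
    and lower parameter q^(2r+1), up to factors independent of n and indexed so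
    that it starts at n = r. *)
Definition vander_term (q : C) (r N n : nat) : C :=
  qpoch (-(1)) q n * q ^ tri (S n) *
    (inv_qfact q n r * inv_qfact q N n * / qpoch q q (n + r)).

(** The certificate at n + 1 is - (1 + q^n) q^(N+1) times the term itself at n. *)
Lemma vander_rec (q : C) (r N K : nat) :
  (Cmod q < 1)%R -> (S N <= K)%nat -> (r <= N)%nat ->
  (1 - q ^ (S N - r)) * (1 - q ^ (S N + r)) * csum (vander_term q r (S N)) K
  = (1 + q ^ S N) * csum (vander_term q r N) K.
Proof.
intros Hq HK Hr.
apply telescope with (fun n => match n with
  | O => 0 | S k => - (1 + q ^ k) * q ^ S N * vander_term q r N k end : C).
- intros [|k]; unfold vander_term.
  + destruct r as [|r]; [|rewrite inv_qfact_0 by lia; simpl; ring].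
    rewrite (inv_qfact_step q N 0) by exact Hq.
    rewrite Nat.sub_0_r, Nat.add_0_r; simpl; ring.
  + rewrite inv_qfact_SS, (inv_qfact_step q N (S k)), inv_qfact_SS by exact Hq.
    destruct (Nat.lt_ge_cases N k) as [H|H].
    { rewrite (inv_qfact_0 q N k) by lia; ring. }
    rewrite (inv_qfact_step q k r) by exact Hq.
    destruct (Nat.lt_ge_cases (S k) r) as [H'|H'].
    { rewrite !(inv_qfact_0 q _ r) by lia; ring. }
    rewrite (inv_qpoch_step q (k + r)) by exact Hq.
    replace (S (k + r)) with (S k + r)%nat by lia.
    generalize (/ qpoch q q (S k + r)) as J; intros J.
    generalize (inv_qfact q N k) as I; intros I.
    generalize (inv_qfact q (S k) r) as I'; intros I'.
    change (qpoch (-(1)) q (S k)) with (qpoch (-(1)) q k * (1 - -(1) * q ^ k)).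
    change (tri (S (S k))) with (tri (S k) + S k)%nat; rewrite (Cpow_add_r q (tri (S k))).
    generalize (qpoch (-(1)) q k) as P; intros P.
    generalize (q ^ tri (S k)) as Q; intros Q.
    (* With S k = r + i and N = k + j every exponent becomes a sum, and the
       claim is a polynomial identity in q^r, q^i and q^j. *)
    assert (exists i, S k = r + i)%nat as [i Ei] by (exists (S k - r)%nat; lia).
    assert (exists j, N = k + j)%nat as [j Ej] by (exists (N - k)%nat; lia).
    replace (S N - S k)%nat with j by lia.
    replace (S N - r)%nat with (i + j)%nat by lia.
    replace (S k - r)%nat with i by lia.
    replace (S N) with (S k + j)%nat by lia. rewrite Ei.
    rewrite !Cpow_add_r. ring.
- reflexivity.
- unfold vander_term; rewrite (inv_qfact_0 q N K) by lia; ring.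
Qed.

(** Both sides vanish for N < r.  For N = r a single term survives, and
    [vander_rec] raises N.  The recurrence cannot lead from N = r - 1 to N = r since
    its coefficient 1 - q^(N+1-r) is then 0. *)
Lemma q_vandermonde (q : C) (r N K : nat) : (Cmod q < 1)%R -> (N <= K)%nat ->
  csum (vander_term q r N) K
  = 2 * q ^ tri (S r) / (1 + q ^ r) * qpoch (- q) q N *
    (inv_qfact q N r * / qpoch q q (N + r)).
Proof.
intros Hq HK; destruct (Nat.lt_ge_cases N r) as [H|H].
- rewrite csum_single with (r := 0%nat).
  + unfold vander_term; rewrite !(inv_qfact_0 q _ r) by lia; ring.
  + lia.
  + intros n _ _; unfold vander_term; destruct (Nat.lt_ge_cases n r).
    * rewrite (inv_qfact_0 q n r) by lia; ring.
    * rewrite (inv_qfact_0 q N n) by lia; ring.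
- induction H as [|N H IH].
  + rewrite csum_single with (r := r); [|lia|].
    * unfold vander_term; rewrite inv_qfact_diag.
      replace (qpoch (-(1)) q r) with (2 * qpoch (- q) q r / (1 + q ^ r)).
      -- unfold Cdiv; ring.
      -- rewrite <- qpoch_minus_one; field; apply one_plus_pow_neq, Hq.
    * intros n _ Hn; unfold vander_term; destruct (Nat.lt_ge_cases n r).
      -- rewrite (inv_qfact_0 q n r) by lia; ring.
      -- rewrite (inv_qfact_0 q r n) by lia; ring.
  + assert (Hc : (1 - q ^ (S N - r)) * (1 - q ^ (S N + r)) <> 0).
    { rewrite Nat.sub_succ_l by lia; apply Cmult_neq_0; apply one_minus_pow_neq, Hq. }
    apply (Cmult_cancel_l _ _ _ Hc).
    rewrite vander_rec, IH by (assumption || lia).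
    rewrite (inv_qfact_step q N r) by exact Hq.
    change (S N + r)%nat with (S (N + r)).
    rewrite (inv_qpoch_step q (N + r)) by exact Hq.
    change (qpoch (- q) q (S N)) with (qpoch (- q) q N * (1 - - q * q ^ N)).
    simpl Cpow; unfold Cdiv; ring.
Qed.

(** Bailey's lemma for this pair: expand beta_n by [bailey_pair], exchange the
    sums, and evaluate the inner one by [q_vandermonde] with r = 2m. *)
Lemma bailey_transform (q : C) (N : nat) : (Cmod q < 1)%R ->
  csum (fun n => q ^ (n ^ 2) * qpoch (-(1)) q n / (qpoch q (q ^ 2) n * qpoch q q n)
     * inv_qfact q N n) N
  = qpoch (- q) q N *
    csum (fun m => sym_weight m * (-(1)) ^ m * q ^ (3 * m ^ 2) *
      (inv_qfact q N (2 * m) * / qpoch q q (N + 2 * m))) N.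
Proof.
intros Hq.
transitivity (csum (fun n => csum (fun m =>
  bailey_alpha q m * vander_term q (2 * m) N n) N) N).
- apply csum_ext; intros n Hn.
  transitivity (qpoch (-(1)) q n * q ^ tri (S n) * inv_qfact q N n *
     (q ^ tri n / (qpoch q q n * qpoch q (q ^ 2) n))).
  + replace (n ^ 2)%nat with (tri (S n) + tri n)%nat
      by (rewrite tri_square; simpl; lia).
    rewrite Cpow_add_r; field.
    split; apply qpoch_neq; try assumption; apply (Cmod_pow_lt_1 q 1 Hq).
  + rewrite <- (bailey_pair q n N Hq Hn), <- csum_scal.
    apply csum_ext; intros m _; unfold vander_term; ring.
- rewrite csum_switch, <- csum_scal; apply csum_ext; intros m _.
  rewrite csum_scal, q_vandermonde by (assumption || lia).
  unfold bailey_alpha.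
  replace (3 * m ^ 2)%nat with (2 * tri m + tri (S (2 * m)))%nat.
  2: { assert (H1 := tri_square m); assert (H2 := tri_square (2 * m)); simpl in *; nia. }
  rewrite (Cpow_add_r q (2 * tri m)).
  generalize (one_plus_pow_neq q (2 * m) Hq).
  generalize (q ^ (2 * m)) as x; intros x Hx.
  generalize (/ qpoch q q (N + 2 * m)) as J; intros J; field; exact Hx.
Qed.

(** * Limits of shifted factorials *)

Lemma qpoch_cv (a q : C) : (Cmod q < 1)%R ->
  (exists B, forall n, Cmod (qpoch a q n) <= B)%R /\
  conv (qpoch a q) (qpoch_inf a q).
Proof.
intros Hq.
destruct (infinite_product_cv (qpoch a q) (fun n => - (a * q ^ n)) (Cmod a) (Cmod q))
  as [HB [l Hl]].
- split; [apply Cmod_ge_0|exact Hq].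
- apply Cmod_ge_0.
- reflexivity.
- reflexivity.
- intros n; rewrite Cmod_opp, Cmod_mult, Cmod_pow; lra.
- split; [eexists; exact HB|].
  unfold qpoch_inf; rewrite (Clim_seq_unique _ _ Hl); exact Hl.
Qed.

(** 1/(1 - x) = 1 + x/(1 - x) writes the reciprocals as an infinite product of the
    same kind.  Since the products and their reciprocals both converge, neither limit
    is 0. *)
Lemma inv_qpoch_cv (a q : C) : (Cmod a < 1)%R -> (Cmod q < 1)%R ->
  (exists B, forall n, Cmod (/ qpoch a q n) <= B)%R /\
  qpoch_inf a q <> 0 /\ conv (fun n => / qpoch a q n) (/ qpoch_inf a q).
Proof.
intros Ha Hq.
assert (Hf : forall n, (Cmod (a * q ^ n) < 1)%R)
  by (intros n; eapply Rle_lt_trans; [apply Cmod_mul_pow_le|]; assumption).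
destruct (infinite_product_cv (fun n => / qpoch a q n)
  (fun n => a * q ^ n / (1 - a * q ^ n)) (/ (1 - Cmod a)) (Cmod q)) as [HB [l Hl]].
- split; [apply Cmod_ge_0|exact Hq].
- left; apply Rinv_0_lt_compat; lra.
- simpl; field.
- intros n; simpl; field; split;
    [apply Cmod_lt_1_neq, Hf|apply qpoch_neq; assumption].
- intros n; rewrite Cmod_div by apply Cmod_lt_1_neq, Hf.
  assert (H1 : (1 - Cmod a <= Cmod (1 - a * q ^ n))%R).
  { assert (T := Cmod_triangle (1 - a * q ^ n) (a * q ^ n)).
    replace (1 - a * q ^ n + a * q ^ n) with (RtoC 1) in T by ring.
    rewrite Cmod_1 in T; assert (T' := Cmod_mul_pow_le a q n Hq); lra. }
  rewrite Rmult_comm; unfold Rdiv; apply Rmult_le_compat.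
  + apply Cmod_ge_0.
  + left; apply Rinv_0_lt_compat; lra.
  + rewrite Cmod_mult, Cmod_pow.
    assert (0 <= Cmod q ^ n)%R by (apply pow_le, Cmod_ge_0); nra.
  + apply Rinv_le_contravar; lra.
- assert (E : qpoch_inf a q * l = 1).
  { apply (conv_unique (fun n => qpoch a q n * / qpoch a q n)).
    - apply conv_mult; [apply qpoch_cv, Hq|exact Hl].
    - apply conv_ext with (2 := conv_const 1).
      intros n; field; apply qpoch_neq; assumption. }
  assert (Hz : qpoch_inf a q <> 0).
  { intros H; rewrite H, Cmult_0_l in E; apply (f_equal fst) in E; simpl in E; lra. }
  split; [eexists; exact HB|split; [exact Hz|]].
  replace (/ qpoch_inf a q) with l; [exact Hl|].
  apply (Cmult_cancel_l _ _ _ Hz); rewrite E; field; exact Hz.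
Qed.

Lemma inv_qfact_cv (q : C) (k : nat) : (Cmod q < 1)%R ->
  conv (fun N => inv_qfact q N k) (/ qpoch_inf q q).
Proof.
intros Hq; destruct (inv_qpoch_cv q q Hq Hq) as [_ [_ H]].
apply (conv_subseq_ge _ (fun N => N - k)%nat k) in H; [|intros n; lia].
eapply filterlim_ext_loc; [|exact H].
exists k; intros n Hn; unfold inv_qfact.
destruct (Nat.leb_spec k n); [reflexivity|lia].
Qed.

Lemma inv_qfact_bounded (q : C) : (Cmod q < 1)%R ->
  exists B, (0 <= B)%R /\ (forall n k, Cmod (inv_qfact q n k) <= B)%R /\
    (forall n, Cmod (/ qpoch q q n) <= B)%R.
Proof.
intros Hq; destruct (inv_qpoch_cv q q Hq Hq) as [[B HB] _].
assert (H0 : (0 <= B)%R) by (eapply Rle_trans; [apply Cmod_ge_0|apply (HB 0%nat)]).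
exists B; repeat split; [exact H0| |exact HB].
intros n k; unfold inv_qfact; destruct (k <=? n)%nat; [apply HB|rewrite Cmod_0; exact H0].
Qed.

(** Both finite theta sums have this shape, with s(m) = m for Gauss's identity and
    s(m) = 2m for the Bailey sum. *)
Lemma bilateral_limit (q : C) (w : nat -> C) (s : nat -> nat) (c : R) (l : C) :
  (Cmod q < 1)%R -> (forall m, Cmod (w m) <= c * Cmod q ^ m)%R -> is_cseries w l ->
  conv (fun N => csum (fun m =>
      w m * (inv_qfact q N (s m) * / qpoch q q (N + s m))) N)
    (/ qpoch_inf q q * / qpoch_inf q q * l).
Proof.
intros Hq Hw Hl.
destruct (inv_qfact_bounded q Hq) as [B [HB0 [HB HB']]].
destruct (tannery
  (fun N m => w m * (inv_qfact q N (s m) * / qpoch q q (N + s m)))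
  (fun m => / qpoch_inf q q * / qpoch_inf q q * w m)
  (fun m => c * (B * B) * Cmod q ^ m)%R) as [l' [H1 H2]].
- apply ex_series_geom_scal, Hq.
- intros N m; rewrite !Cmod_mult.
  replace (c * (B * B) * Cmod q ^ m)%R with (c * Cmod q ^ m * (B * B))%R by ring.
  repeat apply Rmult_le_compat; try apply Rmult_le_pos; try apply Cmod_ge_0; auto.
- intros m.
  rewrite (Cmult_comm _ (w m)).
  apply conv_mult; [apply conv_const|].
  apply conv_mult; [apply inv_qfact_cv, Hq|].
  apply (conv_subseq_ge (fun n => / qpoch q q n) (fun N => N + s m)%nat 0);
    [intros n; lia|apply inv_qpoch_cv; exact Hq].
- rewrite (conv_unique _ _ _ (is_cseries_scal _ _ _ Hl) H1); exact H2.
Qed.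

(** * Theta series *)

Lemma theta_term_diag (a : C) (z : Z) : theta_term a a z = a ^ (Z.abs_nat z ^ 2).
Proof.
unfold theta_term; rewrite <- Cpow_add_r; f_equal.
assert (E : Z.to_nat (z * z) = (Z.abs_nat z ^ 2)%nat).
{ apply Nat2Z.inj; rewrite Z2Nat.id by nia.
  rewrite Nat2Z.inj_pow, Zabs2Nat.id_abs.
  change (Z.of_nat 2) with 2%Z; rewrite Z.pow_2_r; symmetry; apply Z.abs_square. }
rewrite <- E; clear E.
destruct (Z.Even_or_Odd z) as [[k ->]|[k ->]].
- replace (2 * k * (2 * k + 1))%Z with (k * (2 * k + 1) * 2)%Z by ring.
  replace (2 * k * (2 * k - 1))%Z with (k * (2 * k - 1) * 2)%Z by ring.
  rewrite !Z.div_mul by lia; rewrite <- Z2Nat.inj_add by nia; f_equal; ring.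
- replace ((2 * k + 1) * (2 * k + 1 + 1))%Z with ((2 * k + 1) * (k + 1) * 2)%Z by ring.
  replace ((2 * k + 1) * (2 * k + 1 - 1))%Z with ((2 * k + 1) * k * 2)%Z by ring.
  rewrite !Z.div_mul by lia.
  rewrite <- Z2Nat.inj_add by (destruct (Z.le_gt_cases 0 k); nia); f_equal; ring.
Qed.

Lemma Cmod_pow_square_le (a : C) (m : nat) : (Cmod a < 1)%R ->
  (Cmod (a ^ (m ^ 2)) <= Cmod a ^ m)%R.
Proof.
intros Ha; rewrite Cmod_pow, tri_square, pow_add.
rewrite <- (Rmult_1_l (Cmod a ^ m)) at 2.
assert (0 <= Cmod a)%R by apply Cmod_ge_0.
apply Rmult_le_compat_r; [apply pow_le; assumption|].
rewrite <- (pow1 (2 * tri m)); apply pow_incr; lra.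
Qed.

(** The terms with index -(k+1) of the bilateral series coincide with those of index
    k+1, which produces the weight. *)
Lemma theta_diag_series (a : C) : (Cmod a < 1)%R ->
  is_cseries (fun m => sym_weight m * a ^ (m ^ 2)) (theta a a).
Proof.
intros Ha.
assert (Hex : ex_series (K := C_AbsRing) (V := C_NormedModule) (fun m => a ^ (m ^ 2))).
{ apply (ex_series_le (K := C_AbsRing) (V := C_CompleteNormedModule) _
    (fun n => 1 * Cmod a ^ n)%R); [|apply ex_series_geom_scal, Ha].
  intros n; change (Cmod (a ^ (n ^ 2)) <= 1 * Cmod a ^ n)%R.
  rewrite Rmult_1_l; apply Cmod_pow_square_le, Ha. }
assert (H1 : is_cseries (fun k => a ^ (k ^ 2))
  (CSeries (fun k => theta_term a a (Z.of_nat k)))).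
{ apply (is_series_ext (fun k => theta_term a a (Z.of_nat k))).
  2: apply CSeries_correct; apply ex_series_ext with (2 := Hex).
  all: intros k; rewrite theta_term_diag, Zabs2Nat.id; reflexivity. }
assert (H2 : is_cseries (fun k => a ^ (S k ^ 2))
  (CSeries (fun k => theta_term a a (- Z.of_nat (S k))))).
{ apply (is_series_ext (fun k => theta_term a a (- Z.of_nat (S k)))).
  2: { apply CSeries_correct; apply ex_series_incr_1 in Hex.
       apply ex_series_ext with (2 := Hex).
       intros k; rewrite theta_term_diag; do 2 f_equal; lia. }
  intros k; rewrite theta_term_diag; do 2 f_equal; lia. }
set (g := (fun m => match m with O => 0 | S _ => a ^ (m ^ 2) end) : nat -> C).
assert (Hg : is_cseries g (CSeries (fun k => theta_term a a (- Z.of_nat (S k))))).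
{ apply (is_series_decr_1 (K := C_AbsRing) (V := C_NormedModule)).
  assert (E : forall l : C, plus l (opp (g 0%nat)) = l)
    by (intros l; unfold plus, opp; simpl; ring).
  rewrite E; exact H2. }
assert (E : forall m, a ^ (m ^ 2) + g m = sym_weight m * a ^ (m ^ 2))
  by (intros [|m]; unfold g, sym_weight; ring).
apply (is_series_ext _ _ _ E).
exact (is_series_plus (K := C_AbsRing) (V := C_NormedModule) _ _ _ _ H1 Hg).
Qed.

Lemma sign_square (m : nat) : (-(1)) ^ (m ^ 2) = (-(1)) ^ m.
Proof.
rewrite tri_square, Cpow_add_r, Cpow_mult_r.
replace ((-(1)) ^ 2) with (RtoC 1) by (simpl; ring); rewrite Cpow_1_l; ring.
Qed.

Lemma theta_neg_series (q : C) : (Cmod q < 1)%R ->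
  is_cseries (fun m => sym_weight m * (-(1)) ^ m * q ^ (m ^ 2)) (theta (- q) (- q)).
Proof.
intros Hq.
assert (E : forall m,
  sym_weight m * (- q) ^ (m ^ 2) = sym_weight m * (-(1)) ^ m * q ^ (m ^ 2)).
{ intros m; replace (- q) with (-(1) * q) by ring.
  rewrite Cpow_mult_l, sign_square; ring. }
apply (is_series_ext _ _ _ E), theta_diag_series; rewrite Cmod_opp; exact Hq.
Qed.

Lemma theta_neg_terms_le (q : C) (m : nat) : (Cmod q < 1)%R ->
  (Cmod (sym_weight m * (-(1)) ^ m * q ^ (m ^ 2)) <= 2 * Cmod q ^ m)%R.
Proof.
intros Hq; rewrite !Cmod_mult, (Cmod_pow (-(1))), Cmod_m1, pow1, Rmult_1_r.
apply Rmult_le_compat; try apply Cmod_ge_0; [|apply Cmod_pow_square_le, Hq].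
destruct m; unfold sym_weight; rewrite Cmod_R, Rabs_pos_eq; lra.
Qed.

(** Limit of [gauss_finite]: phi(-q) / (q;q)_oo^2 = 1 / ((q;q)_oo (-q;q)_oo). *)
Lemma gauss (q : C) : (Cmod q < 1)%R ->
  theta (- q) (- q) = qpoch_inf q q / qpoch_inf (- q) q.
Proof.
intros Hq; assert (Hq' : (Cmod (- q) < 1)%R) by (rewrite Cmod_opp; exact Hq).
destruct (inv_qpoch_cv q q Hq Hq) as [_ [Hz Hc]].
destruct (inv_qpoch_cv (- q) q Hq' Hq) as [_ [Hz' Hc']].
assert (H := bilateral_limit q _ (fun m => m) 2 _ Hq
  (fun m => theta_neg_terms_le q m Hq) (theta_neg_series q Hq)).
set (P := qpoch_inf q q) in *; set (Q := qpoch_inf (- q) q) in *.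
assert (E : / P * / P * theta (- q) (- q) = / P * / Q).
{ apply (conv_unique _ _ _ H).
  apply conv_ext with (2 := conv_mult _ _ _ _ Hc Hc').
  intros N; rewrite gauss_finite by (assumption || lia).
  field; split; apply qpoch_neq; assumption. }
replace (theta (- q) (- q)) with (P * P * (/ P * / P * theta (- q) (- q)))
  by (field; assumption).
rewrite E; field; split; assumption.
Qed.

(** Separating odd and even factors,
    (q;q)_(2n) = (q;q^2)_n (q^2;q^2)_n = (q;q^2)_n (q;q)_n (-q;q)_n; let n grow. *)
Lemma euler_odd (q : C) : (Cmod q < 1)%R ->
  qpoch_inf q (q ^ 2) = / qpoch_inf (- q) q.
Proof.
intros Hq; assert (Hq' : (Cmod (- q) < 1)%R) by (rewrite Cmod_opp; exact Hq).
destruct (inv_qpoch_cv q q Hq Hq) as [_ [Hz Hc]].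
destruct (inv_qpoch_cv (- q) q Hq' Hq) as [_ [Hz' Hc']].
destruct (qpoch_cv q q Hq) as [_ Hp].
assert (Hfin : forall n,
  qpoch q q (2 * n) = qpoch q (q ^ 2) n * (qpoch q q n * qpoch (- q) q n)).
{ induction n as [|n IH]; [simpl; ring|].
  replace (2 * S n)%nat with (S (S (2 * n))) by lia.
  cbn [qpoch]; rewrite IH, <- Cpow_mult_r.
  replace (2 * n)%nat with (n + n)%nat by lia.
  rewrite (Cpow_S q (n + n)), Cpow_add_r; ring. }
apply (conv_unique (qpoch q (q ^ 2))).
{ apply qpoch_cv; exact (Cmod_pow_lt_1 q 1 Hq). }
replace (/ qpoch_inf (- q) q)
  with (qpoch_inf q q * (/ qpoch_inf q q * / qpoch_inf (- q) q))
  by (field; split; assumption).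
apply conv_ext with (fun n => qpoch q q (2 * n) * (/ qpoch q q n * / qpoch (- q) q n)).
{ intros n; rewrite Hfin; field; split; apply qpoch_neq; assumption. }
apply conv_mult; [|apply conv_mult; assumption].
apply (conv_subseq_ge (qpoch q q) (fun n => 2 * n)%nat 0); [intros n; lia|exact Hp].
Qed.

Lemma gauss_product (q : C) : (Cmod q < 1)%R ->
  theta (- q) (- q) = qpoch_inf q q * qpoch_inf q (q ^ 2).
Proof. intros Hq; rewrite gauss, euler_odd by exact Hq; reflexivity. Qed.

(** * The identity *)

(** The limit of [bailey_transform].  The factor 1/(q;q)_(N-n) tends to 1/(q;q)_oo,
    so Tannery's theorem also yields convergence of the series. *)
Lemma series_limit (q : C) : (Cmod q < 1)%R ->
  is_cseries (fun n : nat =>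
     q ^ (n ^ 2) * qpoch (-(1)) q n / (qpoch q (q ^ 2) n * qpoch q q n))
    (qpoch_inf (- q) q / qpoch_inf q q * theta (- q ^ 3) (- q ^ 3)).
Proof.
intros Hq; assert (Hq' : (Cmod (- q) < 1)%R) by (rewrite Cmod_opp; exact Hq).
assert (Hq2 : (Cmod (q ^ 2) < 1)%R) by exact (Cmod_pow_lt_1 q 1 Hq).
assert (Hq3 : (Cmod (q ^ 3) < 1)%R) by exact (Cmod_pow_lt_1 q 2 Hq).
destruct (inv_qpoch_cv q q Hq Hq) as [_ [Hz _]].
destruct (qpoch_cv (-(1)) q Hq) as [[B1 HB1] _].
destruct (inv_qpoch_cv q (q ^ 2) Hq Hq2) as [[B2 HB2] _].
destruct (inv_qfact_bounded q Hq) as [B [HB0 [HB HB']]].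
set (t := fun n : nat =>
  q ^ (n ^ 2) * qpoch (-(1)) q n / (qpoch q (q ^ 2) n * qpoch q q n)).
destruct (tannery (fun N n => t n * inv_qfact q N n)
  (fun n => / qpoch_inf q q * t n)
  (fun n => B1 * B2 * B * B * Cmod q ^ n)%R) as [l [H1 H2]].
- apply ex_series_geom_scal, Hq.
- intros N n; unfold t.
  replace (q ^ (n ^ 2) * qpoch (-(1)) q n / (qpoch q (q ^ 2) n * qpoch q q n) * inv_qfact q N n)
    with (qpoch (-(1)) q n * / qpoch q (q ^ 2) n * / qpoch q q n * inv_qfact q N n * q ^ (n ^ 2))
    by (field; split; apply qpoch_neq; assumption).
  rewrite !Cmod_mult.
  repeat apply Rmult_le_compat; repeat apply Rmult_le_pos; try apply Cmod_ge_0; auto.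
  apply Cmod_pow_square_le, Hq.
- intros n; rewrite (Cmult_comm _ (t n)).
  apply conv_mult; [apply conv_const|apply inv_qfact_cv, Hq].
- assert (Hw : forall m, (Cmod (sym_weight m * (-(1)) ^ m * q ^ (3 * m ^ 2)) <= 2 * Cmod q ^ m)%R).
  { intros m; rewrite Cpow_mult_r.
    eapply Rle_trans; [apply theta_neg_terms_le, Hq3|].
    apply Rmult_le_compat_l; [lra|apply pow_incr; split; [apply Cmod_ge_0|]].
    replace (q ^ 3) with (q * q ^ 2) by (simpl; ring).
    apply Cmod_mul_pow_le, Hq. }
  assert (Hs : is_cseries (fun m => sym_weight m * (-(1)) ^ m * q ^ (3 * m ^ 2))
     (theta (- q ^ 3) (- q ^ 3))).
  { eapply is_series_ext; [|apply theta_neg_series, Hq3].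
    intros m; rewrite Cpow_mult_r; reflexivity. }
  assert (H := bilateral_limit q _ (fun m => 2 * m)%nat 2 _ Hq Hw Hs).
  assert (E : l = qpoch_inf (- q) q *
     (/ qpoch_inf q q * / qpoch_inf q q * theta (- q ^ 3) (- q ^ 3))).
  { apply (conv_unique _ _ _ H2).
    apply conv_ext with (2 := conv_mult _ _ _ _ (proj2 (qpoch_cv (- q) q Hq)) H).
    intros N; symmetry; exact (bailey_transform q N Hq). }
  replace (qpoch_inf (- q) q / qpoch_inf q q * theta (- q ^ 3) (- q ^ 3))
    with (qpoch_inf q q * l) by (rewrite E; field; exact Hz).
  assert (Et : forall n, qpoch_inf q q * (/ qpoch_inf q q * t n) = t n)
    by (intros n; field; exact Hz).
  exact (is_series_ext _ _ _ Et (is_cseries_scal _ _ _ H1)).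
Qed.

Theorem mainTheorem6 :
  forall q : C, (Cmod q < 1)%R ->
    is_series (K := C_AbsRing) (V := C_NormedModule)
      (fun n : nat =>
         q ^ (n ^ 2) * qpoch (-(1)) q n / (qpoch q (q ^ 2) n * qpoch q q n))
      (theta (- q ^ 3) (- q ^ 3) / phi (- q))
    /\
    theta (- q ^ 3) (- q ^ 3) / phi (- q) =
      (qpoch_inf (q ^ 3) (q ^ 3) * qpoch_inf (q ^ 3) (q ^ 6)) /
      (qpoch_inf q q * qpoch_inf q (q ^ 2)).
Proof.
intros q Hq; assert (Hq' : (Cmod (- q) < 1)%R) by (rewrite Cmod_opp; exact Hq).
destruct (inv_qpoch_cv q q Hq Hq) as [_ [Hz _]].
destruct (inv_qpoch_cv (- q) q Hq' Hq) as [_ [Hz' _]].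
unfold phi; split.
- replace (theta (- q ^ 3) (- q ^ 3) / theta (- q) (- q))
    with (qpoch_inf (- q) q / qpoch_inf q q * theta (- q ^ 3) (- q ^ 3)).
  + apply series_limit, Hq.
  + rewrite (gauss q Hq); field; split; assumption.
- rewrite (gauss_product q Hq), (gauss_product (q ^ 3) (Cmod_pow_lt_1 q 2 Hq)).
  rewrite <- (Cpow_mult_r q 3 2); reflexivity.
Qed.
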